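(* Fix $\beta>0$. Both the sigmoid loss $L(x)=-\frac{1}{1+e^{-\beta x}}$ and the logistic loss $L(x)=-\ln\!\left(\frac{1}{1+e^{-\beta x}}\right)=\ln(1+e^{-\beta x})$ are consistent with AUC (in the sense defined in the context).
   Context: Let $\mathcal{Y}$ be a set of items and let $\mathcal{D}$ be a distribution on $\mathcal{Y}\times\{-1,+1\}$, with marginal $\mathcal{D}_{\mathcal{Y}}$ on $\mathcal{Y}$ and $\eta(y)=P[r=+1\mid y]$. For a measurable scoring function $s:\mathcal{Y}\to\mathbb{R}$, the AUC risk is $R(s)=\mathbb{E}_{(y,r),(y',r')\sim\mathcal{D}}\big[\ell(s,(y,r),(y',r'))\mid r\neq r'\big]$, where $\ell(s,(y,r),(y',r'))=\mathcal{I}\big((r-r')(s(y)-s(y'))<0\big)+\tfrac12\mathcal{I}(s(y)=s(y'))$ and $\mathcal{I}$ is the indicator function; $R(s^* )=\inf_s R(s)$ over measurable $s$ (the Bayes risk). For a surrogate loss $L:\mathbb{R}\to\mathbb{R}$, the surrogate risk is $R_L(s)=\mathbb{E}_{(y,y')\sim\mathcal{D}_{\mathcal{Y}}^2}\big[\eta(y)(1-\eta(y'))L(s(y)-s(y'))+\eta(y')(1-\eta(y))L(s(y')-s(y))\big]$, and $R_L(s^*_L)=\inf_s R_L(s)$. The loss $L$ is called consistent with AUC if for every distribution $\mathcal{D}$ on $\mathcal{Y}\times\{-1,+1\}$ and every sequence of scoring functions $(s^{\langle i\rangle})_{i\ge1}$, $R_L(s^{\langle i\rangle})\to R_L(s^*_L)$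 implies $R(s^{\langle i\rangle})\to R(s^* )$. *)

(* Defs.v *)
From HB Require Import structures.
From mathcomp Require Import all_boot all_order all_algebra.
From mathcomp Require Import all_classical all_reals all_analysis.
Set Implicit Arguments. Unset Strict Implicit. Unset Printing Implicit Defensive.
Import Order.TTheory GRing.Theory Num.Theory.
Import numFieldNormedType.Exports.
Local Open Scope classical_set_scope.
Local Open Scope ring_scope.

(* Labels in {-1,+1} are encoded as booleans: true = +1, false = -1. *)
Definition lab (R : realType) (r : bool) : R := if r then 1 else -1.

Definition scoring (R : realType) d (Y : measurableType d) : set (Y -> R) :=
  [set s | measurable_fun setT s].

Definition marginal (R : realType) d (Y : measurableType d)
  (D : probability (Y * bool)%type R) : set Y -> \bar R :=
  pushforward D fst.

Definition auc_loss (R : realType) d (Y : measurableType d) (s : Y -> R)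
  (z z' : Y * bool) : R :=
  (if (@lab R z.2 - @lab R z'.2) * (s z.1 - s z'.1) < 0 then 1 else 0)
  + 2^-1 * (if s z.1 == s z'.1 then 1 else 0).

(* AUC risk: E_{(z,z') ~ D x D}[ l | r <> r' ] = E[l 1{r<>r'}] / P(r <> r') *)
Definition AUC_risk (R : realType) d (Y : measurableType d)
  (D : probability (Y * bool)%type R) (s : Y -> R) : R :=
  fine (\int[(D \x D)%E]_w
          ((auc_loss s w.1 w.2) * (if w.1.2 != w.2.2 then 1 else 0))%:E)
  / fine ((D \x D)%E [set w | w.1.2 != w.2.2]).

Definition AUC_bayes (R : realType) d (Y : measurableType d)
  (D : probability (Y * bool)%type R) : R :=
  inf [set AUC_risk D s | s in @scoring R _ Y].

Definition is_cond_prob (R : realType) d (Y : measurableType d)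
  (D : probability (Y * bool)%type R) (eta : Y -> R) : Prop :=
  [/\ measurable_fun setT eta,
      (forall y, 0 <= eta y <= 1) &
      forall A : set Y, measurable A ->
        (\int[marginal D]_(y in A) (eta y)%:E = D (A `*` [set true]))%E].

Definition surrogate_risk (R : realType) d (Y : measurableType d)
  (L : R -> R) (D : probability (Y * bool)%type R) (eta : Y -> R)
  (s : Y -> R) : \bar R :=
  (\int[(marginal D \x marginal D)%E]_w
     (eta w.1 * (1 - eta w.2) * L (s w.1 - s w.2)
      + eta w.2 * (1 - eta w.1) * L (s w.2 - s w.1))%:E)%E.

Definition surrogate_bayes (R : realType) d (Y : measurableType d)
  (L : R -> R) (D : probability (Y * bool)%type R) (eta : Y -> R) : \bar R :=
  ereal_inf [set surrogate_risk L D eta s | s in @scoring R _ Y].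

Definition AUC_consistent (R : realType) d (Y : measurableType d)
  (L : R -> R) : Prop :=
  forall (D : probability (Y * bool)%type R) (eta : Y -> R),
    is_cond_prob D eta ->
    forall s : nat -> Y -> R, (forall i, @scoring R _ Y (s i)) ->
      (fun i => surrogate_risk L D eta (s i)) @ \oo --> surrogate_bayes L D eta ->
      (fun i => AUC_risk D (s i)) @ \oo --> AUC_bayes D.

(* Main.v *)
Require Import Defs.
From HB Require Import structures.
From mathcomp Require Import all_boot all_order all_algebra.
From mathcomp Require Import all_classical all_reals all_analysis.
From mathcomp Require Import measurable_realfun ring lra.
Set Implicit Arguments. Unset Strict Implicit. Unset Printing Implicit Defensive.
Import Order.TTheory GRing.Theory Num.Theory.
Import numFieldNormedType.Exports.
Local Open Scope classical_set_scope.
Local Open Scope ring_scope.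

(** Disintegrating [D] along the label turns the numerator of the AUC risk into the surrogate risk
of the pairwise 0-1 loss [l], so both risks are integrals of [a L(t) + b L(-t)] over pairs of items,
with weights [a = eta(y)(1 - eta(y'))] and [b = eta(y')(1 - eta(y))], [a - b = eta(y) - eta(y')],
and [t = s(y) - s(y')].  For [l] the pointwise minimum [min a b] is attained by [s = eta].  For the
two surrogates the pointwise minimum [m a b] is approached, uniformly in the pair of items, by
scoring functions [g o eta], so the Bayes surrogate risk is the integral of [m].  It then suffices
to bound the pointwise AUC excess by [e + C (surrogate excess)] for every [e > 0].  For the sigmoid
loss [C = 2] does.  For the logistic loss the surrogate excess is a Kullback-Leibler divergence,
which dominates the squared Hellinger distance and hence a multiple of the squared AUC excess. *)

(** * Disintegration of [D] along the label *)

Section marginal.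
Context (R : realType) d (Y : measurableType d).
Variable D : probability (Y * bool)%type R.

(** Convertible to [marginal D], but carries the probability structure that Tonelli's theorem and
    the integrability arguments rely on. *)
Definition marginal_prob : probability Y R :=
  distribution D (mfun_Sub (mem_set (@measurable_fst _ _ Y bool)
    : (fst : Y * bool -> Y) \in mfun)).

End marginal.

Section label_density.
Local Open Scope ereal_scope.
Import HBNNSimple.

(** The hypothesis on [h] is the case where [f] is an indicator. Linearity extends it to simple
    functions, and monotone convergence along [nnsfun_approx] to every nonnegative measurable
    [f]. *)
Lemma ge0_integral_label (R : realType) d (Y : measurableType d)
    (D : probability (Y * bool)%type R) (h : Y -> R) (b : bool) (f : Y -> \bar R) :
  measurable_fun setT h -> (forall y, 0 <= h y)%R ->
  (forall A, measurable A -> \int[marginal_prob D]_(y in A) (h y)%:E = D (A `*` [set b])) ->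
  measurable_fun setT f -> (forall y, 0 <= f y) ->
  \int[D]_(z in setT `*` [set b]) f z.1 = \int[marginal_prob D]_y (f y * (h y)%:E).
Proof.
move=> mh h0 hD mf f0.
have mE : measurable (setT `*` [set b] : set (Y * bool)) by exact: measurableX.
pose f_ := nnsfun_approx measurableT mf.
transitivity (limn (fun n => \int[D]_(z in setT `*` [set b]) (f_ n z.1)%:E)).
  rewrite -monotone_convergence//.
  - apply: eq_integral => y _; apply/esym/cvg_lim => //.
    exact: cvg_nnsfun_approx.
  - move=> n; apply/measurable_EFinP; apply: measurable_funTS.
    exact: measurableT_comp.
  - by move=> n y _; rewrite lee_fin.
  - by move=> y _ m n mn; rewrite lee_fin; exact/lefP/nd_nnsfun_approx.
rewrite [X in limn X](_ : _ =
    (fun n => \int[marginal_prob D]_y ((f_ n y)%:E * (h y)%:E))); last first.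
  apply/funext => n.
  transitivity (\sum_(k \in range (f_ n)) k%:E * D ((f_ n @^-1` [set k]) `*` [set b])).
    under eq_integral do rewrite fimfunE -fsumEFin//.
    rewrite ge0_integral_fsum//; last 2 first.
    - move=> r; apply/measurable_EFinP/measurable_funM => //.
      apply: (@measurable_indic _ _ _ _ (fst @^-1` (f_ n @^-1` [set r]))).
      by rewrite -[X in measurable X]setTI; exact: measurable_fst.
    - by move=> r y _; rewrite nnfun_muleindic_ge0.
    apply: eq_fsbigr => r _.
    rewrite (@integralZl_indic _ _ _ _ _ mE (fun r => fst @^-1` (f_ n @^-1` [set r])))//.
    + rewrite integral_indic//; last first.
        by rewrite -[X in measurable X]setTI; exact: measurable_fst.
      congr (_ * D _); apply/seteqP; split => -[y c] /=; tauto.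
    + by move=> r0; rewrite preimage_nnfun0.
    + by rewrite -[X in measurable X]setTI; exact: measurable_fst.
  apply/esym.
  transitivity (\int[marginal_prob D]_y (\sum_(k \in range (f_ n))
      (k%:E * ((h y)%:E * (\1_(f_ n @^-1` [set k]) y)%:E)))).
    apply: eq_integral => y _; rewrite fimfunE -fsumEFin//.
    rewrite ge0_mule_fsuml; last by move=> r; rewrite nnfun_muleindic_ge0.
    by apply: eq_fsbigr => r _; rewrite EFinM -muleA (muleC (h y)%:E).
  have mi k : measurable_fun setT (fun y => (h y)%:E * (\1_(f_ n @^-1` [set k]) y)%:E).
    by apply: emeasurable_funM; exact/measurable_EFinP.
  have i0 k y : 0 <= (h y)%:E * (\1_(f_ n @^-1` [set k]) y)%:E.
    by rewrite mule_ge0 ?lee_fin.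
  have c0 k y : 0 <= k%:E * ((h y)%:E * (\1_(f_ n @^-1` [set k]) y)%:E).
    rewrite muleCA mule_ge0 ?nnfun_muleindic_ge0//.
    by rewrite lee_fin.
  rewrite ge0_integral_fsum//; last first.
    by move=> k; exact: emeasurable_funM.
  apply: eq_fsbigr => k /[!inE] -[y _ <-].
  rewrite ge0_integralZl ?lee_fin//.
  rewrite -hD// [in RHS]integral_mkcond; congr (_ * _).
  by apply: eq_integral => x _; rewrite epatch_indic.
rewrite -monotone_convergence//.
- apply: eq_integral => y _; apply/cvg_lim => //.
  by apply: cvgeZr => //; exact: cvg_nnsfun_approx.
- by move=> n; apply: emeasurable_funM; exact/measurable_EFinP.
- by move=> n y _; rewrite mule_ge0 ?lee_fin.
- move=> y _ m n mn; rewrite -!EFinM lee_fin ler_wpM2r//.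
  exact/lefP/nd_nnsfun_approx.
Qed.

End label_density.

Definition surrogate_integrand (R : realType) d (Y : measurableType d)
    (L : R -> R) (eta s : Y -> R) (w : Y * Y) : R :=
  eta w.1 * (1 - eta w.2) * L (s w.1 - s w.2)
  + eta w.2 * (1 - eta w.1) * L (s w.2 - s w.1).

Section conditional_probability.
Local Open Scope ereal_scope.
Context (R : realType) d (Y : measurableType d).
Variables (D : probability (Y * bool)%type R) (eta : Y -> R).
Hypothesis etaP : is_cond_prob D eta.
Let M := marginal_prob D.

Let meta : measurable_fun setT eta. Proof. by case: etaP. Qed.
Let eta0 y : (0 <= eta y)%R. Proof. by case: etaP => _ /(_ y)/andP[]. Qed.
Let eta1 y : (0 <= 1 - eta y)%R.
Proof. by rewrite subr_ge0; case: etaP => _ /(_ y)/andP[]. Qed.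
Let meta1 : measurable_fun setT (fun y => 1 - eta y)%R.
Proof. exact: measurable_funB. Qed.

(** Both [eta + (1 - eta) = 1] and the split of [D] by label compute [M A]; the part with label
    [true] is finite and cancels. *)
Lemma integral_cond_prob_false A : measurable A ->
  \int[M]_(y in A) (1 - eta y)%:E = D (A `*` [set false]).
Proof.
move=> mA.
have [_ _ /(_ _ mA) etaA] := etaP.
have MA : M A = D (A `*` [set true]) + D (A `*` [set false]).
  rewrite -measureU//; last 3 first.
  - exact: measurableX.
  - exact: measurableX.
  - by apply/seteqP; split => -[y b]//= [[_ ->] []].
  congr (D _); apply/seteqP; split => [[y []] /= Ay|[y b] /= [[]|[]]//];
    by [left|right].
have : M A = \int[M]_(y in A) ((eta y)%:E + (1 - eta y)%:E).
  under eq_integral do rewrite -EFinD subrKC.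
  by rewrite integral_cst// mul1e.
rewrite ge0_integralD//=; [|by move=> *; rewrite lee_fin|
  by apply/measurable_EFinP/measurable_funTS|by move=> *; rewrite lee_fin|
  by apply/measurable_EFinP/measurable_funTS].
rewrite [X in _ = X + _ -> _]etaA MA.
move=> /(congr1 (fun x => x - D (A `*` [set true]))).
rewrite ![D (A `*` [set true]) + _]addeC !addeK//;
  by rewrite fin_num_measure//; exact: measurableX.
Qed.

Lemma ge0_integral_cond_prob (f : Y * bool -> \bar R) :
  measurable_fun setT f -> (forall z, 0 <= f z) ->
  \int[D]_z f z =
  \int[M]_y (f (y, true) * (eta y)%:E + f (y, false) * (1 - eta y)%:E).
Proof.
move=> mf f0.
have mfb b : measurable_fun setT (fun y => f (y, b)) by exact: measurableT_comp.
have -> : [set: Y * bool] = (setT `*` [set true]) `|` (setT `*` [set false]).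
  by apply/seteqP; split => // -[y []] _; [left|right].
rewrite ge0_integral_setU//; last 4 first.
- exact: measurableX.
- exact: measurableX.
- exact: measurable_funTS.
- by apply/disj_setPS => -[y b] /= [[_ ->] []].
rewrite ge0_integralD//; last 4 first.
- by move=> y _; rewrite mule_ge0 ?lee_fin.
- by apply: emeasurable_funM => //; exact/measurable_EFinP.
- by move=> y _; rewrite mule_ge0 ?lee_fin.
- by apply: emeasurable_funM => //; exact/measurable_EFinP.
congr (_ + _).
- rewrite -(@ge0_integral_label _ _ _ _ _ true)//; last by case: etaP.
  by apply: eq_integral => -[y b] /[!inE] -[_ /= ->].
- rewrite -(@ge0_integral_label _ _ _ _ _ false)//; last first.
    exact: integral_cond_prob_false.
  by apply: eq_integral => -[y b] /[!inE] -[_ /= ->].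
Qed.

End conditional_probability.

(** * The pairwise 0-1 loss and the numerator of the AUC risk *)

Definition pair_loss (R : realType) (t : R) : R :=
  (if t < 0 then 1 else 0) + 2^-1 * (if t == 0 then 1 else 0).

Lemma measurable_pair_loss (R : realType) : measurable_fun setT (@pair_loss R).
Proof.
apply: measurable_funD.
  apply: measurable_fun_ifT => //;
  exact: measurable_fun_ltr.
apply: measurable_funM => //.
apply: measurable_fun_ifT => //; exact: measurable_fun_eqr.
Qed.

Lemma pair_loss_ge0 (R : realType) (t : R) : 0 <= pair_loss t.
Proof. by rewrite /pair_loss; case: ifP; case: ifP => _ _; lra. Qed.

Lemma pair_loss_le1 (R : realType) (t : R) : pair_loss t <= 1.
Proof. by rewrite /pair_loss; case: ltrgt0P => _; lra. Qed.

Section auc_numerator.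
Local Open Scope ereal_scope.
Context (R : realType) d (Y : measurableType d).
Variables (D : probability (Y * bool)%type R) (eta : Y -> R).
Hypothesis etaP : is_cond_prob D eta.
Let M := marginal_prob D.

Lemma measurable_surrogate_integrand (L : R -> R) (s : Y -> R) :
  measurable_fun setT L -> measurable_fun setT s ->
  measurable_fun setT (surrogate_integrand L eta s).
Proof.
case: etaP => meta _ _ mL ms.
have m1 (f : Y -> R) : measurable_fun setT f ->
  measurable_fun setT (fun w : Y * Y => f w.1).
  by move=> mf; exact: measurableT_comp.
have m2 (f : Y -> R) : measurable_fun setT f ->
  measurable_fun setT (fun w : Y * Y => f w.2).
  by move=> mf; exact: measurableT_comp.
apply: measurable_funD; apply: measurable_funM.
- by apply: measurable_funM; [exact: m1|apply: measurable_funB => //; exact: m2].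
- by apply: measurableT_comp => //; apply: measurable_funB; [exact: m1|exact: m2].
- by apply: measurable_funM; [exact: m2|apply: measurable_funB => //; exact: m1].
- by apply: measurableT_comp => //; apply: measurable_funB; [exact: m2|exact: m1].
Qed.

(** By Tonelli, the two labels are integrated out one after the other. Of the four label
    combinations only the two mixed ones survive, and they are the two terms of the surrogate
    integrand. *)
Lemma auc_numeratorE (s : Y -> R) : measurable_fun setT s ->
  \int[D \x D]_w
     ((auc_loss s w.1 w.2) * (if w.1.2 != w.2.2 then 1 else 0))%:E
  = surrogate_risk (@pair_loss R) D eta s.
Proof.
move=> ms.
pose l := @pair_loss R.
(* The AUC loss restricted to unequal labels: [l] of the score of the positive item minus that of
   the negative one. *)
pose F (w : (Y * bool) * (Y * bool)) : R :=
  if w.1.2 then if w.2.2 then 0%R else l (s w.1.1 - s w.2.1)%R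
  else if w.2.2 then l (s w.2.1 - s w.1.1)%R else 0%R.
have F0 w : (0 <= F w)%R.
  by rewrite /F; case: ifP; case: ifP => // _ _; exact: pair_loss_ge0.
have mF : measurable_fun setT F.
  apply: measurable_fun_ifT; first by apply: measurableT_comp.
    apply: measurable_fun_ifT => //; first by apply: measurableT_comp.
    apply: measurableT_comp; first exact: measurable_pair_loss.
    by apply: measurable_funB; apply: measurableT_comp => //; apply: measurableT_comp.
  apply: measurable_fun_ifT => //; first by apply: measurableT_comp.
  apply: measurableT_comp; first exact: measurable_pair_loss.
  by apply: measurable_funB; apply: measurableT_comp => //; apply: measurableT_comp.
transitivity (\int[D \x D]_w (F w)%:E).
  apply: eq_integral => -[[y r] [y' r']] _; congr (_%:E).
  rewrite /auc_loss /F /lab /l /pair_loss /=.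
  have -> : (s y == s y') = (s y - s y' == 0)%R by rewrite subr_eq0.
  by case: r; case: r' => /=; rewrite ?mulr0 ?mulr1//;
    do !case: ltrgt0P => ?; lra.
have mEF : measurable_fun setT (EFin \o F) by exact/measurable_EFinP.
have EF0 w : 0 <= (EFin \o F) w by rewrite lee_fin.
have [meta etab _] := etaP.
have eta0 y : (0 <= eta y)%R by have /andP[] := etab y.
have eta1 y : (0 <= 1 - eta y)%R by rewrite subr_ge0; have /andP[] := etab y.
rewrite (fubini_tonelli1 (EFin \o F))//.
rewrite (ge0_integral_cond_prob etaP); last 2 first.
- exact: measurable_fun_fubini_tonelli_F.
- by move=> z; apply: integral_ge0 => z' _; rewrite lee_fin.
pose S := surrogate_integrand l eta s.
have mS : measurable_fun setT (EFin \o S).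
  apply/measurable_EFinP; apply: measurable_surrogate_integrand => //.
  exact: measurable_pair_loss.
transitivity (\int[M \x M]_w (EFin \o S) w) => //.
rewrite fubini_tonelli1//; last first.
  move=> w; rewrite lee_fin addr_ge0// mulr_ge0 ?pair_loss_ge0// mulr_ge0//.
apply: eq_integral => y _; rewrite /fubini_F.
rewrite !(ge0_integral_cond_prob etaP)//; last 2 first.
- by apply: measurableT_comp.
- by apply: measurableT_comp.
rewrite /= /F /=.
have ml (f : Y -> R) : measurable_fun setT f ->
    measurable_fun setT (fun x => (l (f x))%:E).
  move=> mf; apply/measurable_EFinP; apply: measurableT_comp => //.
  exact: measurable_pair_loss.
have meta1 : measurable_fun setT (fun y => 1 - eta y)%R by exact: measurable_funB.
under eq_integral do rewrite mul0e add0e.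
under [X in _ + X * _]eq_integral do rewrite mul0e adde0.
have mp : measurable_fun setT (fun x => (l (s y - s x))%:E * (1 - eta x)%:E).
  apply: emeasurable_funM; last exact/measurable_EFinP.
  by apply: ml; exact: measurable_funB.
have mn : measurable_fun setT (fun x => (l (s x - s y))%:E * (eta x)%:E).
  apply: emeasurable_funM; last exact/measurable_EFinP.
  by apply: ml; exact: measurable_funB.
have l0 t : 0 <= (l t)%:E by rewrite lee_fin; exact: pair_loss_ge0.
have e0 x : 0 <= (eta x)%:E by rewrite lee_fin.
have e1 x : 0 <= (1 - eta x)%:E by rewrite lee_fin.
rewrite -!ge0_integralZr//; [|by move=> *; exact: mule_ge0..].
rewrite -ge0_integralD//; [|by move=> *; rewrite !mule_ge0
  |exact: emeasurable_funM|by move=> *; rewrite !mule_ge0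
  |exact: emeasurable_funM].
apply: eq_integral => y' _; rewrite /S /surrogate_integrand/= -!EFinM -EFinD.
by congr (_%:E); ring.
Qed.

End auc_numerator.

(** The negative part is bounded, so an integral below [+oo] forces the positive part to be
    integrable too. This serves surrogate losses that are unbounded above, such as the logistic
    one. *)
Lemma integrable_lbound (R : realType) d (T : measurableType d)
    (mu : {finite_measure set T -> \bar R}) (f : T -> R) (k : R) :
  measurable_fun setT f -> (forall x, - k <= f x) ->
  (\int[mu]_x (f x)%:E < +oo)%E -> mu.-integrable setT (EFin \o f).
Proof.
move=> mf kf fy.
have mEf : measurable_fun setT (EFin \o f) by exact/measurable_EFinP.
have negy : (\int[mu]_x (EFin \o f)^\- x < +oo)%E.
  apply: (@le_lt_trans _ _ (\int[mu]_x (cst `|k|%:E) x)%E).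
    apply: ge0_le_integral => //; first exact: measurable_funeneg.
    move=> x _; rewrite funenegE -EFinN -EFin_max lee_fin ge_max normr_ge0 andbT.
    by rewrite (le_trans _ (ler_norm k))// lerNl.
  by rewrite integral_cst// lte_mul_pinfty// ?lee_fin// -ge0_fin_numE// fin_num_measure.
apply/integrableP; split => //.
under eq_integral do rewrite -[(`|_|)%E]/((abse \o (EFin \o f)) _) fune_abse.
rewrite ge0_integralD//; [|exact: measurable_funepos|exact: measurable_funeneg].
rewrite lte_add_pinfty//.
have negE : (\int[mu]_x (EFin \o f)^\- x)%E \is a fin_num.
  by rewrite ge0_fin_numE//; exact: integral_ge0.
move: fy; rewrite (integralE mu setT (EFin \o f)) -(fineK negE).
by case: (\int[mu]_x (EFin \o f)^\+ x)%E => [r| |] //=; rewrite ?ltry ?ltNyy//.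
Qed.

(** * The 0-1 risk of a single pair of items *)

Definition pair_weights (R : realType) (a b : R) := [/\ 0 <= a, 0 <= b & a + b <= 1].

(** The sum of the weights is the probability that the two labels differ; its complement is
    [x * y + (1 - x) * (1 - y)]. *)
Lemma pair_weights_cond_prob (R : realType) (x y : R) :
  0 <= x <= 1 -> 0 <= y <= 1 -> pair_weights (x * (1 - y)) (y * (1 - x)).
Proof. by move=> /andP[x0 x1] /andP[y0 y1]; split; nra. Qed.

(** Since [pair_loss t + pair_loss (- t) = 1], the right-hand side is a convex combination of [a]
    and [b]. *)
Lemma pair_risk_ge_min (R : realType) (a b t : R) : pair_weights a b ->
  Num.min a b <= a * pair_loss t + b * pair_loss (- t).
Proof.
move=> [a0 b0 _]; rewrite /pair_loss oppr_lt0 oppr_eq0 ge_min.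
by case: ltrgt0P => _; have [?|?] := leP a b; apply/orP; lra.
Qed.

(** The difference of the weights is [x - y], so the sign of [x - y] selects the smaller weight; in
    a tie the weights agree. *)
Lemma pair_risk_cond_prob (R : realType) (x y : R) :
  x * (1 - y) * pair_loss (x - y) + y * (1 - x) * pair_loss (y - x) =
  Num.min (x * (1 - y)) (y * (1 - x)).
Proof.
rewrite -(opprB x y) /pair_loss oppr_lt0 oppr_eq0.
by case: ltrgt0P => h; case: leP; nra.
Qed.

(** * From pointwise calibration to AUC consistency *)

Section calibration.
Context (R : realType) (L : R -> R) (m : R -> R -> R).
Hypothesis mL : measurable_fun setT L.
Hypothesis mm : measurable_fun setT (fun p : R * R => m p.1 p.2).
Hypothesis m_ge : forall a b, pair_weights a b -> -1 <= m a b.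
Hypothesis m_le : forall a b t, pair_weights a b ->
  m a b <= a * L t + b * L (- t).
Hypothesis m_inf : forall e, 0 < e -> exists2 g : R -> R, measurable_fun setT g &
  forall x y, 0 <= x <= 1 -> 0 <= y <= 1 ->
    x * (1 - y) * L (g x - g y) + y * (1 - x) * L (g y - g x)
    <= m (x * (1 - y)) (y * (1 - x)) + e.
(** An affine bound integrates directly, whereas a square-root bound on the excess would call for
    Jensen's inequality; the slack [e] pays for the difference. *)
Hypothesis m_calibrated : forall e, 0 < e -> exists2 C, 0 <= C &
  forall a b t, pair_weights a b ->
    a * pair_loss t + b * pair_loss (- t) - Num.min a b
    <= e + C * (a * L t + b * L (- t) - m a b).

Context d (Y : measurableType d).

Lemma calibrated_AUC_consistent : AUC_consistent Y L.
Proof.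
move=> D eta etaP s ms risk_cvg.
have [meta etab _] := etaP.
pose M := marginal_prob D.
pose W : probability _ R := (M \x M)%E.
pose H K s := surrogate_integrand K eta s.
pose a (w : Y * Y) := eta w.1 * (1 - eta w.2).
pose b (w : Y * Y) := eta w.2 * (1 - eta w.1).
have wP w : pair_weights (a w) (b w) by exact: pair_weights_cond_prob.
have HE K f w : H K f w = a w * K (f w.1 - f w.2) + b w * K (- (f w.1 - f w.2)).
  by rewrite opprB.
pose m' w := m (a w) (b w).
have ma : measurable_fun setT a.
  apply: measurable_funM; first exact: measurableT_comp.
  by apply: measurable_funB => //; exact: measurableT_comp.
have mb : measurable_fun setT b.
  apply: measurable_funM; first exact: measurableT_comp.
  by apply: measurable_funB => //; exact: measurableT_comp.
have mm' : measurable_fun setT m'.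
  apply: (@measurableT_comp _ _ _ _ _ _ (fun p : R * R => m p.1 p.2) _ (fun w => (a w, b w))) => //.
  exact: measurable_fun_pair.
have mH K f : measurable_fun setT K -> measurable_fun setT f ->
    measurable_fun setT (H K f).
  by move=> mK mf; exact: (measurable_surrogate_integrand etaP).
have bnd_int (f : Y * Y -> R) k : measurable_fun setT f -> (forall w, `|f w| <= k) ->
    W.-integrable setT (EFin \o f).
  move=> mf fk; apply: measurable_bounded_integrable => //.
    by rewrite -ge0_fin_numE// fin_num_measure.
  exists k; split; first exact: num_real.
  by move=> x kx w _ /=; exact: le_trans (fk w) (ltW kx).
(* The constant score [t = 0] already has pair risk [(a + b) * L 0]. *)
have m_ub w : m' w <= `|L 0|.
  have := m_le 0 (wP w); rewrite oppr0 -/(m' w).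
  have [a0 b0 ab1] := wP w.
  by have := ler_norm (L 0); have := normr_ge0 (L 0); nra.
have im : W.-integrable setT (EFin \o m').
  apply: (@bnd_int _ (`|L 0| + 1)) => // w.
  rewrite ler_norml; apply/andP; split.
    by have := m_ge (wP w); have := normr_ge0 (L 0); rewrite /m'; lra.
  by have := m_ub w; lra.
have iP f : measurable_fun setT f -> W.-integrable setT (EFin \o H (@pair_loss R) f).
  move=> mf; apply: (@bnd_int _ 1); first by apply: mH => //; exact: measurable_pair_loss.
  move=> w; rewrite HE ler_norml.
  have [a0 b0 ab1] := wP w; set t := f w.1 - f w.2.
  have := pair_loss_ge0 t; have := pair_loss_le1 t.
  have := pair_loss_ge0 (- t); have := pair_loss_le1 (- t).
  by move=> *; apply/andP; split; nra.
have H_ge f w : -1 <= H L f w by rewrite HE (le_trans (m_ge (wP w)))// m_le.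
have iH f : measurable_fun setT f -> surrogate_risk L D eta f \is a fin_num ->
    W.-integrable setT (EFin \o H L f).
  move=> mf fin; apply: (@integrable_lbound _ _ _ _ (H L f) 1) => //; first exact: mH.
  by move: fin; rewrite fin_numElt => /andP[].
pose m1 := \int[W]_w m' w.
have m1E : m1%:E = (\int[W]_w (m' w)%:E)%E.
  by rewrite /m1 /Rintegral fineK//; exact: integrable_fin_num.
have risk_ge f : measurable_fun setT f -> (m1%:E <= surrogate_risk L D eta f)%E.
  (* Monotonicity of the integral is applied to integrable functions, so infinite risk is treated
     apart. *)
  move=> mf; have [->|fy] := eqVneq (surrogate_risk L D eta f) +oo%E; first by rewrite leey.
  rewrite m1E; apply: le_integral => //.
    apply: (@integrable_lbound _ _ _ _ (H L f) 1) => //; first exact: mH.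
    by rewrite ltey.
  move=> w _; rewrite lee_fin.
  by have := m_le (f w.1 - f w.2) (wP w); rewrite -(HE L f w).
have bayesE : surrogate_bayes L D eta = m1%:E.
  apply/eqP; rewrite eq_le; apply/andP; split; last first.
    by apply/ereal_infP => _ [f mf <-]; exact: risk_ge.
  apply/lee_addgt0Pr => e e0.
  have [g mg gP] := m_inf e0.
  apply: (@le_trans _ _ (surrogate_risk L D eta (g \o eta))).
    by apply: ereal_inf_lbound; exists (g \o eta) => //; exact: measurableT_comp.
  have ic : W.-integrable setT (EFin \o (cst e : Y * Y -> R)).
    exact: finite_measure_integrable_cst.
  have -> : e%:E = (\int[W]_w (cst e%:E) w)%E.
    rewrite integral_cst//= [X in (_ * X)%E](@probability_setT _ _ _ W).
    by rewrite mule1.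
  rewrite m1E.
  rewrite -(@integralD _ _ _ W setT measurableT (EFin \o m') (EFin \o cst e) im ic).
  apply: (@le_integral _ _ _ W setT measurableT (EFin \o H L (g \o eta))
    ((EFin \o m') \+ (EFin \o cst e))%E).
  - apply: (@bnd_int (H L (g \o eta)) (`|L 0| + 2 + e)).
      by apply: mH => //; exact: measurableT_comp.
    move=> w; rewrite ler_norml.
    have h1 := H_ge (g \o eta) w; have h2 := gP _ _ (etab w.1) (etab w.2).
    have h3 := m_ub w; rewrite /m' /a /b in h3; rewrite /H /surrogate_integrand /= in h1 *.
    have h4 := normr_ge0 (L 0).
    by apply/andP; split; lra.
  - exact: integrableD.
  - by move=> w _; rewrite /= -EFinD lee_fin; exact: gP.
(* If the labels almost surely agree, [P = 0], [P^-1 = 0] by convention and every AUC risk is 0. The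
   rest uses only [0 <= P^-1], which covers this case. *)
pose P := fine ((D \x D)%E [set w | w.1.2 != w.2.2]).
have P0 : 0 <= P^-1 by rewrite invr_ge0 fine_ge0.
have aucE f : measurable_fun setT f ->
    AUC_risk D f = (\int[W]_w H (@pair_loss R) f w) / P.
  by move=> mf; rewrite /AUC_risk (auc_numeratorE etaP).
have auc_ge f : measurable_fun setT f -> AUC_risk D eta <= AUC_risk D f.
  move=> mf; rewrite !aucE// ler_wpM2r//; apply: le_Rintegral => //; [exact: iP..|].
  move=> w _; rewrite [leRHS]HE [leLHS]pair_risk_cond_prob.
  exact: pair_risk_ge_min (wP w).
have auc_bayesE : AUC_bayes D = AUC_risk D eta.
  apply/eqP; rewrite eq_le; apply/andP; split.
    apply: ge_inf; last by exists eta.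
    by exists (AUC_risk D eta) => _ [f mf <-]; exact: auc_ge.
  apply: lb_le_inf; first by exists (AUC_risk D eta), eta.
  by move=> _ [f mf <-]; exact: auc_ge.
(* The limit is finite, so the risks are eventually finite and their integrands integrable. *)
rewrite bayesE in risk_cvg; case/fine_cvgP: risk_cvg => risk_fin risk_cvg.
rewrite auc_bayesE; apply/cvgrPdist_le => e e0.
(* The slack and the scaled surrogate excess will each contribute at most [l * P^-1]. The added 1,
   here and in [C + 1] below, avoids dividing by zero. *)
pose l := e / (2 * (P^-1 + 1)).
have l0 : 0 < l by rewrite divr_gt0// mulr_gt0// ltr_wpDl.
have [C C0 hC] := m_calibrated l0.
have lC0 : 0 < l / (C + 1) by rewrite divr_gt0// ltr_wpDl.
move/cvgrPdist_le : risk_cvg => /(_ _ lC0) risk_near.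
near=> i.
have ifin : surrogate_risk L D eta (s i) \is a fin_num by near: i.
have idist : `|m1 - fine (surrogate_risk L D eta (s i))| <= l / (C + 1) by near: i.
have iHi := iH _ (ms i) ifin.
have gap : \int[W]_w H (@pair_loss R) (s i) w - \int[W]_w H (@pair_loss R) eta w
   <= l + C * (\int[W]_w H L (s i) w - m1).
  have ic : W.-integrable setT (EFin \o (cst l : Y * Y -> R)).
    exact: finite_measure_integrable_cst.
  have iB : W.-integrable setT (EFin \o (fun w => H L (s i) w - m' w)).
    exact: (integrableB measurableT iHi im).
  have iC : W.-integrable setT (EFin \o (fun w => C * (H L (s i) w - m' w))).
    exact: (integrableZl measurableT C iB).
  have ilC : W.-integrable setT (EFin \o (fun w => l + C * (H L (s i) w - m' w))).
    exact: (integrableD measurableT ic iC).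
  rewrite -(RintegralB measurableT (iP _ (ms i)) (iP _ meta)).
  have -> : l + C * (\int[W]_w H L (s i) w - m1) =
      \int[W]_w (l + C * (H L (s i) w - m' w)).
    rewrite (RintegralD measurableT ic iC).
    rewrite Rintegral_cst// [X in fine X](@probability_setT _ _ _ W) mulr1.
    by rewrite (RintegralZl C measurableT iB) (RintegralB measurableT iHi im).
  apply: le_Rintegral => //.
    exact: (integrableB measurableT (iP _ (ms i)) (iP _ meta)).
  move=> w _; rewrite [X in _ - X <= _]pair_risk_cond_prob.
  by rewrite !(HE _ (s i)); exact: hC.
have riskE : fine (surrogate_risk L D eta (s i)) = \int[W]_w H L (s i) w by [].
rewrite riskE in idist.
have excess : C * (\int[W]_w H L (s i) w - m1) <= l.
  have /(ler_wpM2l C0) h : \int[W]_w H L (s i) w - m1 <= l / (C + 1).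
    by rewrite (le_trans _ idist)// distrC ler_norm.
  rewrite (le_trans h)// mulrA ler_pdivrMr ?ltr_wpDl//.
  by rewrite mulrC ler_pM2l// lerDl.
rewrite distrC ger0_norm ?subr_ge0; last exact/auc_ge/ms.
rewrite !aucE//; last exact: ms.
rewrite -mulrBl (@le_trans _ _ (2 * l * P^-1))//.
  by rewrite ler_wpM2r//; lra.
have <- : 2 * l * (P^-1 + 1) = e.
  rewrite /l; move: (P^-1) (P0) => q q0; field.
  by rewrite gt_eqF// ltr_wpDl.
by apply: ler_wpM2l; [rewrite mulr_ge0// ltW|rewrite lerDl].
Unshelve. all: by end_near.
Qed.

End calibration.

(** * Entropy bounds for the logistic loss *)

Section logistic_entropy.
Context (R : realType).

(* A vanishing weight contributes [0 * ln 0 = 0], with [ln 0] a junk value. *)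
Definition logistic_min (a b : R) : R := (a + b) * ln (a + b) - a * ln a - b * ln b.

Lemma le_lnB1 (x : R) : 0 < x -> ln x <= x - 1.
Proof. by move=> x0; rewrite -[in leLHS](subrKC 1 x) le_ln1Dx//; lra. Qed.

(* Summed over the two outcomes, this bounds the Kullback-Leibler divergence below by the squared
   Hellinger distance; it is [ln z <= z - 1] at [z = sqrt (q / a)]. *)
Lemma hellinger_term (a q : R) : 0 <= a -> 0 < q ->
  2 * a - 2 * (Num.sqrt a * Num.sqrt q) <= a * (ln a - ln q).
Proof.
move=> a0 q0; have [->|an0] := eqVneq a 0; first by rewrite sqrtr0 !mul0r; lra.
have r0 : 0 < Num.sqrt a by rewrite sqrtr_gt0 lt0r an0.
have p0 : 0 < Num.sqrt q by rewrite sqrtr_gt0.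
suff h r p : 0 < r -> 0 < p ->
    2 * r ^+ 2 - 2 * (r * p) <= r ^+ 2 * (ln (r ^+ 2) - ln (p ^+ 2)) :> R.
  by have := h _ _ r0 p0; rewrite !sqr_sqrtr// ltW.
move=> {}r0 {}p0; rewrite !lnXn//.
have := le_lnB1 (divr_gt0 p0 r0); rewrite ln_div ?posrE//.
move=> /(ler_wpM2l (exprn_ge0 2 (ltW r0))).
have -> : r ^+ 2 * (p / r - 1) = r * p - r ^+ 2 by field; rewrite gt_eqF.
by rewrite !mulr2n; lra.
Qed.

(** The right-hand side is the divergence of [(a, b)] from [((a + b) * u, (a + b) * (1 - u))]. These
    have equal mass, so the two instances of [hellinger_term] add up to a sum of two squares of
    differences of roots, of which the first is kept. *)
Lemma logistic_excess (a b u : R) : pair_weights a b -> 0 < u < 1 ->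
  (a - (a + b) * u) ^+ 2 / 4 <= a * - ln u + b * - ln (1 - u) - logistic_min a b.
Proof.
move=> [a0 b0 ab1] /andP[u0 u1]; rewrite /logistic_min.
have [S0|S0] := eqVneq (a + b) 0.
  have [-> ->] : a = 0 /\ b = 0 by lra.
  by rewrite addr0 !mul0r; lra.
have Sgt0 : 0 < a + b by rewrite lt0r S0 addr_ge0.
have v0 : 0 < 1 - u by lra.
have q1 : 0 < (a + b) * u by exact: mulr_gt0.
have q2 : 0 < (a + b) * (1 - u) by exact: mulr_gt0.
have := hellinger_term a0 q1; have := hellinger_term b0 q2.
rewrite !lnM ?posrE//.
have := sqr_sqrtr a0; have := sqr_sqrtr b0.
have := sqr_sqrtr (ltW q1); have := sqr_sqrtr (ltW q2).
have := sqrtr_ge0 a; have := sqrtr_ge0 ((a + b) * u).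
have : Num.sqrt a <= 1 by rewrite -sqrtr1 ler_wsqrtr//; lra.
have : Num.sqrt ((a + b) * u) <= 1 by rewrite -sqrtr1 ler_wsqrtr//; nra.
move: (Num.sqrt a) (Num.sqrt b) (Num.sqrt ((a + b) * u)) (Num.sqrt ((a + b) * (1 - u))).
move=> ra rb p1 p2 p11 ra1 p10 ra0 Hp2 Hp1 Hrb Hra h2 h1.
(* Factor the difference of squares: both roots are at most 1, so [(ra + p1) ^+ 2 <= 4]. *)
have e1 : (a - (a + b) * u) ^+ 2 / 4 <= (ra - p1) ^+ 2.
  rewrite -Hp1 -Hra subr_sqr exprMn -mulrA ler_piMr ?sqr_ge0//.
  by rewrite ler_pdivrMr// mul1r; nra.
have e2 : 0 <= (rb - p2) ^+ 2 by exact: sqr_ge0.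
by rewrite !sqrrB in e1 e2; lra.
Qed.

Lemma ler_mul_ln (a c : R) : 0 <= a <= c -> a * ln a <= a * ln c.
Proof.
move=> /andP[a0 ac]; have [->|an0] := eqVneq a 0; first by rewrite !mul0r.
have a_gt0 : 0 < a by rewrite lt0r an0.
by rewrite ler_wpM2l// ler_ln// posrE// (lt_le_trans a_gt0).
Qed.

(** [logistic_min a b] is [a + b] times the binary entropy of [a / (a + b)]. *)
Lemma logistic_min_ge0 (a b : R) : 0 <= a -> 0 <= b -> 0 <= logistic_min a b.
Proof.
move=> a0 b0; rewrite /logistic_min.
have : a * ln a <= a * ln (a + b) by apply: ler_mul_ln; lra.
have : b * ln b <= b * ln (a + b) by apply: ler_mul_ln; lra.
by lra.
Qed.

(* Additive smoothing: with [A] and [B] in place of [a] and [b] the minimiser of the pairwise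
   logistic risk is finite even when [a] or [b] vanishes. *)
Lemma logistic_min_smoothing (a b A B : R) : 0 <= a <= A -> 0 <= b <= B ->
  0 < A + B ->
  a * (ln (A + B) - ln A) + b * (ln (A + B) - ln B)
  <= logistic_min a b + (A + B - (a + b)).
Proof.
move=> /andP[a0 aA] /andP[b0 bB] T0; rewrite /logistic_min.
have : a * ln a <= a * ln A by apply: ler_mul_ln; rewrite a0.
have : b * ln b <= b * ln B by apply: ler_mul_ln; rewrite b0.
suff : (a + b) * ln (A + B) <= (a + b) * ln (a + b) + (A + B - (a + b)) by lra.
have [->|S0] := eqVneq (a + b) 0; first by rewrite !mul0r; lra.
have Sgt0 : 0 < a + b by rewrite lt0r S0 addr_ge0.
(* [ln z <= z - 1] at [z = (A + B) / (a + b)], then multiplied by [a + b]. *)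
have := le_lnB1 (divr_gt0 T0 Sgt0); rewrite ln_div ?posrE//.
move=> /(ler_wpM2l (ltW Sgt0)).
have -> : (a + b) * ((A + B) / (a + b) - 1) = A + B - (a + b) by field.
by lra.
Qed.

End logistic_entropy.

(** * The sigmoid function and consistency of the two losses *)

Section sigmoid.
Context (R : realType) (beta : R).
Hypothesis beta_gt0 : 0 < beta.

Definition sigmoid (t : R) : R := (1 + expR (- (beta * t)))^-1.

Lemma sigmoid_den_gt0 t : 0 < 1 + expR (- (beta * t)).
Proof. by rewrite ltr_wpDr// expR_ge0. Qed.

Lemma sigmoid_gt0 t : 0 < sigmoid t.
Proof. by rewrite invr_gt0 sigmoid_den_gt0. Qed.

Lemma sigmoidN t : sigmoid (- t) = 1 - sigmoid t.
Proof.
rewrite /sigmoid (_ : expR (- (beta * - t)) = (expR (- (beta * t)))^-1); last first.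
  by rewrite mulrN opprK expRN invrK.
move: (expR (- (beta * t))) (expR_gt0 (- (beta * t))) => x x0.
by field; rewrite !gt_eqF// ltr_wpDr// ltW.
Qed.

Lemma sigmoid_lt1 t : sigmoid t < 1.
Proof. by rewrite -subr_gt0 -sigmoidN sigmoid_gt0. Qed.

Lemma sigmoid_ge_half t : 0 <= t -> 2^-1 <= sigmoid t.
Proof.
move=> t0; rewrite /sigmoid lef_pV2 ?posrE ?sigmoid_den_gt0//.
by rewrite -[leRHS]/(1 + 1) lerD2l -expR0 ler_expR oppr_le0 mulr_ge0// ltW.
Qed.

Lemma sigmoid_le_half t : t <= 0 -> sigmoid t <= 2^-1.
Proof.
rewrite -oppr_ge0 => /sigmoid_ge_half; rewrite sigmoidN; lra.
Qed.

Lemma sigmoid0 : sigmoid 0 = 2^-1.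
Proof. by apply/eqP; rewrite eq_le sigmoid_le_half// sigmoid_ge_half. Qed.

Lemma measurable_sigmoid : measurable_fun setT sigmoid.
Proof.
(* Writing the inverse through [expR] and [ln] leaves a composition of measurable functions. *)
have -> : sigmoid = fun t => expR (- ln (1 + expR (- (beta * t)))).
  by apply/funext => t; rewrite expRN lnK// posrE sigmoid_den_gt0.
apply: measurableT_comp => //; apply: measurableT_comp => //.
apply: measurableT_comp => //; apply: measurable_funD => //.
by apply: measurableT_comp => //; apply: measurableT_comp.
Qed.

(** The scale makes the exponent [c / e], and [1 + c / e <= expR (c / e)] concludes. No lower bound
    on [c] is involved: a small gap [c] is poorly separated but costs little. *)
Lemma sigmoid_tail e c : 0 < e -> 0 <= c ->
  c * sigmoid (- ((e * beta)^-1 * c)) <= e.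
Proof.
move=> e0 c0; rewrite /sigmoid ler_pdivrMr ?sigmoid_den_gt0//.
have -> : - (beta * - ((e * beta)^-1 * c)) = c / e.
  by field; rewrite !gt_eqF.
have /(ler_wpM2l (ltW e0)) := expR_ge1Dx (c / e).
have -> : e * (1 + c / e) = e + c by field; rewrite gt_eqF.
by lra.
Qed.

Lemma sigmoid_AUC_consistent d (Y : measurableType d) :
  AUC_consistent Y (fun t => - sigmoid t).
Proof.
apply: (@calibrated_AUC_consistent _ _ (fun a b => - Num.max a b)).
- by apply: measurableT_comp => //; exact: measurable_sigmoid.
- apply: measurableT_comp => //.
  by apply: measurable_maxr; [exact: measurable_fst|exact: measurable_snd].
- by move=> a b [a0 b0 ab]; case: (leP a b); lra.
- move=> a b t [a0 b0 ab]; rewrite sigmoidN.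
  by have := sigmoid_gt0 t; have := sigmoid_lt1 t; case: (leP a b); nra.
(* The infimum [- max a b] is approached as the score difference grows, hence a large multiple of
   [eta]. Its excess is [c * sigmoid (- ((e * beta)^-1 * c))] with [c] the absolute value of
   [x - y], which [sigmoid_tail] bounds by [e]. *)
- move=> e e0; exists ( *%R (e * beta)^-1); first exact: measurable_funM.
  move=> x y _ _; rewrite -!mulrBr -(opprB x y) [_^-1 * - _]mulrN.
  have [xy|/ltW] := leP 0 (x - y).
    have := mulr_ge0 xy (ltW (sigmoid_gt0 ((e * beta)^-1 * (x - y)))).
    have := sigmoid_tail e0 xy; rewrite !sigmoidN; move: (sigmoid _) => u.
    by case: (leP (x * (1 - y)) _); lra.
  rewrite -oppr_ge0 => xy.
  have := sigmoid_tail e0 xy; rewrite mulrN opprK sigmoidN; move: (sigmoid _) => u.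
  by case: (leP (x * (1 - y)) _); lra.
(* A wrongly ordered pair has 0-1 excess [max a b - min a b], while the sigmoid puts at least half
   of its mass on the wrong side: hence the factor 2. *)
- move=> e e0; exists 2 => // a b t [a0 b0 ab].
  rewrite sigmoidN /pair_loss oppr_lt0 oppr_eq0.
  case: ltrgt0P => [t0|t0|->].
  + have := sigmoid_ge_half (ltW t0); have := sigmoid_lt1 t.
    by case: (leP a b); nra.
  + have := sigmoid_le_half (ltW t0); have := sigmoid_gt0 t.
    by case: (leP a b); nra.
  + by rewrite sigmoid0; case: (leP a b); lra.
Qed.

(** The score difference that minimises the logistic risk for weights [A] and [B] is the log-odds
    over [beta], where [sigmoid] equals [A / (A + B)]. *)
Lemma sigmoid_ln_odds (A B : R) : 0 < A -> 0 < B ->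
  - ln (sigmoid (beta^-1 * (ln A - ln B))) = ln (A + B) - ln A.
Proof.
move=> A0 B0; rewrite /sigmoid mulVKf ?gt_eqF// opprB.
rewrite -[ln B - ln A]ln_div ?posrE// lnK ?posrE ?divr_gt0//.
rewrite -lnV ?posrE ?invr_gt0 ?ltr_wpDl ?ltW ?divr_gt0//.
rewrite invrK -ln_div ?posrE ?addr_gt0//.
by congr ln; field; rewrite gt_eqF.
Qed.

Lemma logistic_AUC_consistent d (Y : measurableType d) :
  AUC_consistent Y (fun t => - ln (sigmoid t)).
Proof.
have excess a b t : pair_weights a b ->
    (a - (a + b) * sigmoid t) ^+ 2 / 4 <=
    a * - ln (sigmoid t) + b * - ln (sigmoid (- t)) - logistic_min a b.
  by move=> w; rewrite sigmoidN; apply: logistic_excess; rewrite ?sigmoid_gt0 ?sigmoid_lt1.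
apply: (@calibrated_AUC_consistent _ _ (@logistic_min R)).
- apply: measurableT_comp => //; apply: measurableT_comp => //.
  exact: measurable_sigmoid.
- have m1 : measurable_fun setT (fst : R * R -> R) by exact: measurable_fst.
  have m2 : measurable_fun setT (snd : R * R -> R) by exact: measurable_snd.
  have mD : measurable_fun setT (fun p : R * R => p.1 + p.2) by exact: measurable_funD.
  by apply: measurable_funB; first apply: measurable_funB;
    apply: measurable_funM => //; exact: measurableT_comp.
- by move=> a b [a0 b0 _]; rewrite (le_trans _ (logistic_min_ge0 a0 b0)).
- move=> a b t w; rewrite -subr_ge0 (le_trans _ (excess _ _ _ w))//.
  by rewrite divr_ge0// sqr_ge0.
- move=> e e0.
  (* With [A] and [B] below, the smoothing error [A + B - (a + b)] is [2 * c + 2 * c ^+ 2], at most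
     [4 * c <= e]. *)
  pose c := Num.min 1 (e / 4).
  have c0 : 0 < c by rewrite lt_min ltr01 divr_gt0.
  have [c1 ce] : c <= 1 /\ c <= e / 4 by split; rewrite ge_min lexx ?orbT.
  exists (fun x => beta^-1 * (ln (x + c) - ln (1 - x + c))).
    apply: measurable_funM => //; apply: measurable_funB.
      by apply: measurableT_comp => //; exact: measurable_funD.
    apply: measurableT_comp => //; apply: measurable_funD => //.
    exact: measurable_funB.
  move=> x y /andP[x0 x1] /andP[y0 y1].
  have [xc yc] : 0 < x + c /\ 0 < y + c by lra.
  have [xc' yc'] : 0 < 1 - x + c /\ 0 < 1 - y + c by lra.
  (* Smoothing the factors rather than the products keeps [ln A - ln B] a difference of a function
     of [x] and the same function of [y], so it comes from a scoring function. *)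
  set A := (x + c) * (1 - y + c); set B := (y + c) * (1 - x + c).
  have [A0 B0] : 0 < A /\ 0 < B by split; exact: mulr_gt0.
  have lnAB : ln A - ln B =
      (ln (x + c) - ln (1 - x + c)) - (ln (y + c) - ln (1 - y + c)).
    by rewrite !lnM ?posrE//; ring.
  have lnBA : ln B - ln A =
      (ln (y + c) - ln (1 - y + c)) - (ln (x + c) - ln (1 - x + c)).
    by rewrite !lnM ?posrE//; ring.
  rewrite -!mulrBr -lnAB -lnBA !sigmoid_ln_odds// (addrC B A).
  apply: (le_trans (logistic_min_smoothing _ _ (addr_gt0 A0 B0))).
  + by rewrite /A; apply/andP; split; nra.
  + by rewrite /B; apply/andP; split; nra.
  + by rewrite lerD2l /A /B; nra.
(* From [dl ^+ 2 / 16 <= E] and [0 <= (e - dl / 2) ^+ 2] follows [e * dl <= e ^+ 2 + 4 * E];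
   dividing by [e] gives the constant. *)
- move=> e e0; exists (4 / e); first by rewrite divr_ge0// ltW.
  move=> a b t w.
  set E := _ - logistic_min a b; set dl := _ - Num.min a b.
  have dlE : dl ^+ 2 / 16 <= E.
    apply: le_trans (excess a b t w).
    have dl0 : 0 <= dl by rewrite subr_ge0 pair_risk_ge_min.
    (* If [t] orders the pair wrongly, [(a + b) / 2] lies between [a] and [(a + b) * sigmoid t], so
       these are at least [dl / 2] apart. *)
    have dl_le : dl <= 2 * `|a - (a + b) * sigmoid t|.
      have [a0 b0 _] := w.
      rewrite /dl /pair_loss oppr_lt0 oppr_eq0.
      have := ler_norm (a - (a + b) * sigmoid t).
      have := ler_norm (- (a - (a + b) * sigmoid t)); rewrite normrN.
      have S0 : 0 <= a + b by exact: addr_ge0.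
      case: ltrgt0P => [t0|t0|->].
      * have /(ler_wpM2l S0) := sigmoid_ge_half (ltW t0).
        by case: (leP a b); lra.
      * have /(ler_wpM2l S0) := sigmoid_le_half (ltW t0).
        by case: (leP a b); lra.
      * by rewrite sigmoid0; case: (leP a b); lra.
    rewrite -(real_normK (num_real (a - _))).
    by have := lerXn2r 2 dl0 (le_trans dl0 dl_le) dl_le; rewrite exprMn; lra.
  rewrite -(ler_pM2l e0).
  have -> : e * (e + 4 / e * E) = e ^+ 2 + 4 * E by field; rewrite gt_eqF.
  by have := sqr_ge0 (e - dl / 2); rewrite sqrrB; lra.
Qed.

End sigmoid.

Theorem mainTheorem1 (R : realType) (beta : R) (hbeta : 0 < beta)
  (d : measure_display) (Y : measurableType d) :
  AUC_consistent Y (fun x : R => - (1 + expR (- (beta * x)))^-1) /\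
  AUC_consistent Y (fun x : R => - ln ((1 + expR (- (beta * x)))^-1)).
Proof.
by split; [exact: sigmoid_AUC_consistent|exact: logistic_AUC_consistent].
Qed.
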